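(* Let $r\ge1$ and let $G=\overline{\langle a_1,\dots,a_r\rangle}\subset W$ be the closed subgroup topologically generated by the elements $a_1,\dots,a_r\in W$ determined by $a_1=(a_r,1)\,\sigma$ and $a_i=(a_{i-1},1)$ for $2\le i\le r$. Set $a_0:=a_1\cdots a_r$. Consider any elements $b_1,\dots,b_r\in W$ and set $b_0:=b_1\cdots b_r$. Then the following are equivalent: (a) $b_0$ is conjugate to $(b_0,1)\,\sigma$ under $W$, $b_1$ is conjugate to $(b_r,1)\,\sigma$ under $W$, and $b_i$ is conjugate to $(b_{i-1},1)$ under $W$ for any $2\le i\le r$. (b) $b_i$ is conjugate to $a_i$ under $W$ for any $0\le i\le r$. (c) There exist $w\in W$ and $x_0,\dots,x_r\in G$ such that $b_i=(wx_i)a_i(wx_i)^{-1}$ for any $0\le i\le r$. Moreover, for any $w$ as in (c), the closed subgroup of $W$ topologically generated by $b_0,\dots,b_r$ is equal to $wGw^{-1}$, and the coset $wG$ is uniquely determined (i.e. it is the same for all $w$ as in (c)).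
   Context: $T$ is the infinite rooted binary tree whose vertices are the finite words over $\{0,1\}$, with root the empty word, each word $t$ being joined by an edge to $t0$ and $t1$. $W:=\operatorname{Aut}(T)$ is its automorphism group, a profinite group as the inverse limit of the finite groups $W_n=\operatorname{Aut}(T_n)$, where $T_n\subset T$ is the subtree of words of length $\le n$. For $u,v\in W$, $(u,v)\in W$ denotes the automorphism $0t\mapsto 0\,u(t)$, $1t\mapsto 1\,v(t)$ for all words $t$; $\sigma\in W$ is the automorphism of order $2$ with $0t\mapsto 1t$ and $1t\mapsto 0t$. Thus $W=(W\times W)\rtimes\langle\sigma\rangle$. The recursion relations for $a_1,\dots,a_r$ have a unique solution in $W$. *)

(* Defs.v *)
From HB Require Import structures.
From mathcomp Require Import all_boot monoid.
From mathcomp Require Import boolp classical_sets filter topology.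

Set Implicit Arguments.
Unset Strict Implicit.
Unset Printing Implicit Defensive.

Local Open Scope classical_set_scope.
Local Open Scope group_scope.

(* Vertices of the rooted binary tree [T]: the letters 0 and 1 are [false] and
   [true], and the head of the list is the first letter of the word. *)
Definition word := seq bool.

Definition child (s t : word) : bool :=
  (t == rcons s false) || (t == rcons s true).

Definition edge (s t : word) : bool := child s t || child t s.

Record W := TreeAut {
  aut_fun :> word -> word;
  aut_bij : bijective aut_fun;
  aut_root : aut_fun [::] = [::];
  aut_edge : forall s t, edge (aut_fun s) (aut_fun t) = edge s t }.

HB.instance Definition _ := gen_eqMixin W.
HB.instance Definition _ := gen_choiceMixin W.

Lemma W_ext (u v : W) : (forall t, u t = v t) -> u = v.
Proof.
case: u v => [f f1 f2 f3] [g g1 g2 g3] /= /funext fg.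
by subst g; congr TreeAut; apply: Prop_irrelevance.
Qed.

Definition W_one : W :=
  @TreeAut id (Bijective (frefl id) (frefl id)) erefl (fun _ _ => erefl).

Lemma W_comp_root (u v : W) : (u \o v) [::] = [::].
Proof. by rewrite /= !aut_root. Qed.

Lemma W_comp_edge (u v : W) s t : edge ((u \o v) s) ((u \o v) t) = edge s t.
Proof. by rewrite /= !aut_edge. Qed.

(* Automorphisms act on words from the left: [(u * v) t = u (v t)]. *)
Definition W_mul (u v : W) : W :=
  TreeAut (bij_comp (aut_bij u) (aut_bij v)) (W_comp_root u v)
    (W_comp_edge u v).

Lemma W_inverse_exists (u : W) : exists v : W, W_mul v u = W_one.
Proof.
have [g ug gu] := aut_bij u.
have g0 : g [::] = [::] by rewrite -[in LHS](aut_root u) ug.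
have ge s t : edge (g s) (g t) = edge s t by rewrite -(aut_edge u) !gu.
by exists (TreeAut (Bijective gu ug) g0 ge); apply: W_ext => t /=; rewrite ug.
Qed.

Definition W_inv (u : W) : W := projT1 (cid (W_inverse_exists u)).

Lemma W_mulA : associative W_mul.
Proof. by move=> u v w; apply: W_ext. Qed.

Lemma W_mul1 : left_id W_one W_mul.
Proof. by move=> u; apply: W_ext. Qed.

Lemma W_mulr1 : right_id W_one W_mul.
Proof. by move=> u; apply: W_ext. Qed.

Lemma W_mulV : left_inverse W_one W_inv W_mul.
Proof. by move=> u; rewrite /W_inv; case: cid. Qed.

Lemma W_mulrV : right_inverse W_one W_inv W_mul.
Proof.
move=> u; rewrite -[LHS]W_mul1 -{1}(W_mulV (W_inv u)) -W_mulA.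
by rewrite (W_mulA (W_inv u)) W_mulV W_mul1 W_mulV.
Qed.

HB.instance Definition _ :=
  isGroup.Build W W_mulA W_mul1 W_mulr1 W_mulV W_mulrV.

(* [agree n u v]: [u] and [v] have the same image in [Aut(T_n)].  The profinite
   topology has the fibres of [W -> Aut(T_n)], for all [n], as a base. *)
Definition agree (n : nat) (u v : W) : Prop :=
  forall t : word, size t <= n -> u t = v t.

Definition W_nbhs (u : W) : set_system W :=
  filter_from [set: nat] (fun n => [set v | agree n u v]).

HB.instance Definition _ := hasNbhs.Build W W_nbhs.

Lemma W_nbhs_filter (u : W) : ProperFilter (nbhs u).
Proof.
apply: filter_from_proper => [|n _]; last by exists u.
apply: filter_from_filter; first by exists 0%N.
move=> m n _ _; exists (maxn m n) => // v uv.
by split=> t tn; apply: uv; rewrite leq_max tn ?orbT.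
Qed.

Lemma W_nbhs_singleton (u : W) (A : set W) : nbhs u A -> A u.
Proof. by move=> [n _]; apply. Qed.

Lemma W_nbhs_nbhs (u : W) (A : set W) : nbhs u A -> nbhs u (nbhs^~ A).
Proof.
move=> [n _ nA]; exists n => // v uv; exists n => // w vw; apply: nA => t tn.
by rewrite uv // vw.
Qed.

HB.instance Definition _ :=
  Nbhs_isNbhsTopological.Build W W_nbhs_filter W_nbhs_singleton W_nbhs_nbhs.

Lemma child_cons x y (s t : word) :
  child (x :: s) (y :: t) = (x == y) && child s t.
Proof. by rewrite /child /= !eqseq_cons (eq_sym y) -andb_orr. Qed.

Lemma child_nil (s : word) : child s [::] = false.
Proof. by case: s. Qed.

Lemma child_nil_cons x (t : word) : child [::] (x :: t) = (t == [::]).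
Proof. by rewrite /child /= !eqseq_cons -andb_orl; case: x. Qed.

Definition pair_fun (u v : word -> word) (t : word) : word :=
  match t with
  | [::] => [::]
  | false :: t' => false :: u t'
  | true :: t' => true :: v t'
  end.

Lemma pair_bij (u v : W) : bijective (pair_fun u v).
Proof.
have [g ug gu] := aut_bij u; have [h vh hv] := aut_bij v.
by exists (pair_fun g h) => -[|[] t] //=; rewrite ?ug ?gu ?vh ?hv.
Qed.

Lemma aut_eq_nil (u : W) t : (u t == [::]) = (t == [::]).
Proof. by rewrite -{1}(aut_root u) (bij_eq (aut_bij u)). Qed.

Lemma pair_edge (u v : W) s t :
  edge (pair_fun u v s) (pair_fun u v t) = edge s t.
Proof.
by case: s t => [|[] s] [|[] t] //=;
  rewrite /edge ?child_cons ?child_nil ?child_nil_cons ?aut_eq_nil //=;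
  exact: aut_edge.
Qed.

Definition pairW (u v : W) : W := TreeAut (pair_bij u v) erefl (pair_edge u v).

Definition sigma_fun (t : word) : word :=
  if t is x :: t' then ~~ x :: t' else [::].

Lemma sigma_funK : involutive sigma_fun.
Proof. by move=> [|[] t]. Qed.

Lemma sigma_edge s t : edge (sigma_fun s) (sigma_fun t) = edge s t.
Proof.
by case: s t => [|x s] [|y t] //=;
  rewrite /edge ?child_cons ?child_nil ?child_nil_cons //= !(inj_eq negb_inj).
Qed.

Definition sigma : W :=
  TreeAut (Bijective sigma_funK sigma_funK) erefl sigma_edge.

Definition conjugate (G : groupType) (x y : G) : Prop :=
  exists w : G, x = w * y * w^-1.

Definition generated (G : groupType) (S : set G) : set G :=
  smallest (fun H : set G => group_closed [in H]) S.

Definition top_generated (S : set W) : set W := closure (generated S).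

(* A family [c_0, c_1, ..., c_r] is a function on [nat] whose values beyond [r]
   play no role. *)
Definition zeroth_is_product (r : nat) (c : nat -> W) : Prop :=
  c 0%N = \prod_(1 <= i < r.+1) c i.

Definition generators_recursion (r : nat) (a : nat -> W) : Prop :=
  a 1%N = pairW (a r) 1 * sigma /\
  forall i, (2 <= i <= r)%N -> a i = pairW (a i.-1) 1.

(* Main.v *)
(* Rigidity is proved level by level. If b_i ~ a_i for all i, then after one
   conjugation b_1 = (c_r, 1) sigma and every b_{j+1} is (c_j, 1) or (1, c_j),
   with c_j ~ a_j; moreover b_0 ~ (P c_r Q, 1) sigma, where P and Q are the
   products of the c_j of the first and of the second kind. Reordering
   P c_r Q into a product c'_1 ... c'_r only conjugates the c_j inside the group
   that they generate, so the induction hypothesis at the previous level applies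
   to c', and a solution w for c' yields the solution (w, w) for b, because
   (g, g), (a_j, 1) and (1, a_j) with j < r lie in G for all g in G. Compactness
   of W then gives (b) => (c). Uniqueness of w G only uses b_0: the centralizer
   of the odometer a_0 is the closure of <a_0>, which lies in G. *)

Require Import Defs.
From mathcomp Require Import all_boot monoid.
From mathcomp Require Import boolp classical_sets filter topology.

Set Implicit Arguments.
Unset Strict Implicit.
Unset Printing Implicit Defensive.

Local Open Scope classical_set_scope.
Local Open Scope group_scope.

(** * Generated subgroups and conjugation in an abstract group *)

Definition subgroup (G : groupType) (H : set G) : Prop :=
  [/\ H 1, forall x y, H x -> H y -> H (x * y) & forall x, H x -> H x^-1].

Lemma subgroupP (G : groupType) (H : set G) :
  subgroup H <-> group_closed [in H].
Proof.
split=> [[H1 HM HV]|cH].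
  by split=> [|x y]; rewrite !inE // => Hx Hy; apply/HM/HV.
split=> [|x y Hx Hy|x Hx].
- by have := cH.1; rewrite inE.
- by have /(_ x y) := group_closedM cH; rewrite !inE; apply.
- by have /(_ x) := group_closedV cH; rewrite !inE; apply.
Qed.

Lemma subgroupJ (G : groupType) (H : set G) x y :
  subgroup H -> H x -> H y -> H (x ^ y).
Proof. by case=> _ HM HV Hx Hy; rewrite conjgE; exact: HM (HV _ Hy) (HM _ _ Hx Hy). Qed.

Lemma generated_subgroup (G : groupType) (S : set G) :
  subgroup (generated S).
Proof.
split=> [|x y Sx Sy|x Sx] H [cH SH].
- by have [] := (subgroupP H).2 cH.
- have [_ HM _] := (subgroupP H).2 cH.
  by apply: HM; [apply: Sx|apply: Sy].
- have [_ _ HV] := (subgroupP H).2 cH.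
  by apply: HV; apply: Sx.
Qed.

Lemma generated_min (G : groupType) (S H : set G) :
  subgroup H -> S `<=` H -> generated S `<=` H.
Proof. by move=> /subgroupP; apply: smallest_sub. Qed.

Lemma generated_incl (G : groupType) (S : set G) : S `<=` generated S.
Proof. exact: sub_gen_smallest. Qed.

Lemma subgroup_preimJ (G : groupType) (H : set G) (w : G) :
  subgroup H -> subgroup [set x | H (x ^ w)].
Proof.
move=> [H1 HM HV]; split=> [|x y|x] /=; first by rewrite conj1g.
  by rewrite conjMg; apply: HM.
by rewrite conjVg; apply: HV.
Qed.

(** The inner lemmas conjugate on the right, [y ^ w = w^-1 * y * w], so each conjugator there is the
    inverse of the one in [conjugate]. *)
Lemma conjugateP (G : groupType) (x y : G) :
  conjugate x y <-> exists w, x = y ^ w.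
Proof.
split=> -[w ->]; exists w^-1; rewrite conjgE ?invgK ?mulgA //.
Qed.

Lemma conjg_trans (G : groupType) (x y z : G) :
  (exists w, x = y ^ w) -> (exists w, y = z ^ w) -> exists w, x = z ^ w.
Proof. by move=> [v ->] [w ->]; exists (w * v); rewrite conjgM. Qed.

(** * Automorphisms as pairs, up to the swap *)

Lemma W_mulE (u v : W) t : (u * v) t = u (v t). Proof. by []. Qed.

(** Edges are undirected, so orientation must be recovered. If a child of [rcons t y] were sent to
    the parent of [u (rcons t y)], which is [u t] by induction, injectivity would identify [t] with
    its grandchild. *)
Lemma aut_child (u : W) t x : child (u t) (u (rcons t x)).
Proof.
have uI := bij_inj (aut_bij u).
elim/last_ind: t x => [|t y IH] x.
  have := aut_edge u [::] [:: x]; rewrite aut_root /edge child_nil orbF.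
  by rewrite child_nil_cons eqxx => ->.
have := aut_edge u (rcons t y) (rcons (rcons t y) x).
have -> : edge (rcons t y) (rcons (rcons t y) x).
  by rewrite /edge /child; case: (x); rewrite eqxx ?orbT.
case/orP => // E.
have utE : u t = u (rcons (rcons t y) x).
  move: (IH y) E; rewrite /child => /orP[]/eqP-> /orP[]/eqP/rcons_inj[] //.
have := congr1 size (uI _ _ utE); rewrite !size_rcons => /eqP.
by rewrite ltn_eqF.
Qed.

Lemma aut_behead (u : W) x t : exists t', u (x :: t) = u [:: x] ++ t'.
Proof.
elim/last_ind: t => [|t y [t' IH]]; first by exists [::]; rewrite cats0.
have := aut_child u (x :: t) y; rewrite rcons_cons.
by case/orP => /eqP ->; rewrite IH rcons_cat; eexists.
Qed.

Lemma W_mulKV (u : W) : cancel u^-1 u.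
Proof. by move=> t; rewrite -W_mulE mulgV. Qed.

Lemma W_mulVK (u : W) : cancel u u^-1.
Proof. by move=> t; rewrite -W_mulE mulVg. Qed.

Lemma aut_size (u : W) t : size (u t) = size t.
Proof.
elim/last_ind: t => [|t y IH]; first by rewrite aut_root.
by case/orP: (aut_child u t y) => /eqP ->; rewrite !size_rcons IH.
Qed.

Definition section_fun (u : W) (x : bool) (t : word) : word := behead (u (x :: t)).

Lemma section_funE (u : W) x t :
  u [:: x] = [:: x] -> u (x :: t) = x :: section_fun u x t.
Proof.
by move=> ux; rewrite /section_fun; have [t' ->] := aut_behead u x t; rewrite ux.
Qed.

Lemma section_bij (u : W) x : u [:: x] = [:: x] -> bijective (section_fun u x).
Proof.
move=> ux; have vx : u^-1 [:: x] = [:: x] by rewrite -{1}ux W_mulVK.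
exists (section_fun u^-1 x) => t.
  by rewrite {1}/section_fun -section_funE // W_mulVK.
by rewrite {1}/section_fun -section_funE // W_mulKV.
Qed.

Lemma section_root (u : W) x : u [:: x] = [:: x] -> section_fun u x [::] = [::].
Proof. by rewrite /section_fun => ->. Qed.

Lemma section_edge (u : W) x s t : u [:: x] = [:: x] ->
  edge (section_fun u x s) (section_fun u x t) = edge s t.
Proof.
move=> ux; have := aut_edge u (x :: s) (x :: t).
by rewrite !(section_funE _ ux) /edge !child_cons eqxx.
Qed.

Definition sect (u : W) x (ux : u [:: x] = [:: x]) : W :=
  TreeAut (section_bij ux) (section_root ux)
    (fun s t => section_edge s t ux).

Lemma pairW_sect (u : W) (u0 : u [:: false] = [:: false]) (u1 : u [:: true] = [:: true]) :
  u = pairW (sect u0) (sect u1).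
Proof.
by apply: W_ext => -[|[] t] /=;
  rewrite ?aut_root ?(section_funE _ u0) ?(section_funE _ u1).
Qed.

Lemma sigma2 : sigma * sigma = 1.
Proof. by apply: W_ext => t; apply: sigma_funK. Qed.

Lemma sigmaV : sigma^-1 = sigma.
Proof. by apply: (mulIg sigma); rewrite mulVg sigma2. Qed.

(** This is the decomposition of [W] as the semidirect product of [W] x [W] with [sigma]: an
    automorphism fixing one vertex of length 1 fixes the other, and one moving them does so after
    multiplication by [sigma]. *)
Lemma W_cases (u : W) :
  (exists x y, u = pairW x y) \/ (exists x y, u = pairW x y * sigma).
Proof.
have fix_both (v : W) : v [:: false] = [:: false] -> exists x y, v = pairW x y.
  move=> v0; suff v1 : v [:: true] = [:: true].
    by exists (sect v0), (sect v1); apply: pairW_sect.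
  have := aut_size v [:: true]; case E: (v _) => [|[] [|? ?]] // _.
  by have := bij_inj (aut_bij v) (etrans E (esym v0)).
have := aut_size u [:: false]; case E: (u _) => [|[] [|? ?]] // _; last first.
  by left; apply: fix_both.
right; have [|x [y uE]] := fix_both (u * sigma).
  have := aut_size u [:: true]; rewrite W_mulE /=.
  case E': (u _) => [|[] [|? ?]] // _.
  by have := bij_inj (aut_bij u) (etrans E' (esym E)).
by exists x, y; rewrite -uE -mulgA sigma2 mulg1.
Qed.

Lemma pairWM (x y x' y' : W) : pairW x y * pairW x' y' = pairW (x * x') (y * y').
Proof. by apply: W_ext => -[|[] t]. Qed.

Lemma pairW1 : pairW 1 1 = 1.
Proof. by apply: W_ext => -[|[] t]. Qed.

Lemma pairWV (x y : W) : (pairW x y)^-1 = pairW x^-1 y^-1.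
Proof. by apply: (mulIg (pairW x y)); rewrite mulVg pairWM !mulVg pairW1. Qed.

Lemma pairWJ (x y x' y' : W) : pairW x y ^ pairW x' y' = pairW (x ^ x') (y ^ y').
Proof. by rewrite conjgE pairWV !pairWM. Qed.

Lemma pairW_sigma (x y : W) : sigma * pairW x y = pairW y x * sigma.
Proof. by apply: W_ext => -[|[] t]. Qed.

Lemma pairW_inj (x y x' y' : W) : pairW x y = pairW x' y' -> x = x' /\ y = y'.
Proof.
move=> E; split; apply: W_ext => t.
  by have /(congr1 (@behead bool)) := congr1 (fun f : W => f (false :: t)) E.
by have /(congr1 (@behead bool)) := congr1 (fun f : W => f (true :: t)) E.
Qed.

Lemma swapJ (x y u v : W) :
  (pairW x y * sigma) ^ pairW u v = pairW (u^-1 * x * v) (v^-1 * y * u) * sigma.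
Proof.
by rewrite conjgE -!mulgA pairW_sigma pairWV !mulgA !pairWM.
Qed.

Lemma swapJ_diag (x u : W) :
  (pairW x 1 * sigma) ^ pairW u u = pairW (x ^ u) 1 * sigma.
Proof. by rewrite swapJ mulg1 mulVg conjgE mulgA. Qed.

(** The second coordinate can be moved into the first, so up to conjugacy only the product [y * x]
    matters. *)
Lemma swap_normal (x y : W) :
  pairW x y * sigma = (pairW (y * x) 1 * sigma) ^ pairW y 1.
Proof. by rewrite swapJ invg1 !mulg1 mul1g mulKg. Qed.

Lemma sigmaJ (x y : W) : pairW x y ^ sigma = pairW y x.
Proof. by rewrite conjgE sigmaV mulgA pairW_sigma -mulgA sigma2 mulg1. Qed.

(** The two shapes of a conjugate of [pairW a 1]; [s] tells whether the conjugator swapped the two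
    halves of the tree. *)
Definition leaf (s : bool) (c : W) : W := if s then pairW 1 c else pairW c 1.

Lemma leafJ s c u : leaf s c ^ pairW u u = leaf s (c ^ u).
Proof. by case: s; rewrite /leaf pairWJ conj1g. Qed.

Lemma leaf_swapJ s c x : leaf s c ^ (pairW x 1 * sigma) =
  if s then pairW c 1 else pairW 1 (c ^ x).
Proof. by rewrite conjgM; case: s; rewrite /leaf pairWJ conj1g sigmaJ ?conjg1. Qed.

Lemma conj_leaf (b a : W) : (exists w, b = pairW a 1 ^ w) ->
  exists s c, b = leaf s c /\ exists w, c = a ^ w.
Proof.
move=> [w ->]; case: (W_cases w) => -[x [y ->]].
  by exists false, (a ^ x); rewrite pairWJ conj1g; split=> //; exists x.
by exists true, (a ^ x); rewrite conjgM pairWJ conj1g sigmaJ; split=> //; exists x.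
Qed.

(** The class of [y * x] is an invariant of the class of [pairW x y * sigma]: it is the second
    coordinate of the square. *)
Lemma conj_swap (b a : W) : (exists w, b = (pairW a 1 * sigma) ^ w) ->
  exists x y, b = pairW x y * sigma /\ exists w, y * x = a ^ w.
Proof.
move=> [w ->]; case: (W_cases w) => -[u [v ->]].
  rewrite swapJ; do 2!eexists; split; first reflexivity.
  by exists v; rewrite mulg1 conjgE !mulgA mulgK.
rewrite conjgM swapJ conjMg sigmaJ (conjgE sigma) mulKg.
do 2!eexists; split; first reflexivity.
by exists u; rewrite mulg1 conjgE !mulgA mulgK.
Qed.

Lemma pair_conj (x y : W) : (exists w, x = y ^ w) ->
  exists w, pairW x 1 = pairW y 1 ^ w.
Proof. by move=> [w ->]; exists (pairW w w); rewrite pairWJ conj1g. Qed.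

Lemma swap_conj (x y : W) : (exists w, x = y ^ w) ->
  exists w, pairW x 1 * sigma = (pairW y 1 * sigma) ^ w.
Proof. by move=> [w ->]; exists (pairW w w); rewrite swapJ_diag. Qed.

(** * Congruence modulo the stabilizer of a level *)

Lemma agree_refl n (u : W) : agree n u u. Proof. by []. Qed.

Lemma agree_sym n (u v : W) : agree n u v -> agree n v u.
Proof. by move=> uv t tn; rewrite uv. Qed.

Lemma agree_trans n (u v w : W) : agree n u v -> agree n v w -> agree n u w.
Proof. by move=> uv vw t tn; rewrite uv ?vw. Qed.

Lemma agreeM n (u v u' v' : W) :
  agree n u u' -> agree n v v' -> agree n (u * v) (u' * v').
Proof. by move=> uu vv t tn; rewrite !W_mulE vv // uu // aut_size. Qed.

Lemma agreeV n (u v : W) : agree n u v -> agree n u^-1 v^-1.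
Proof.
move=> uv t tn; rewrite -{1}(W_mulKV v t) -uv ?W_mulVK //.
by rewrite aut_size.
Qed.

Lemma agreeJ n (u v u' v' : W) :
  agree n u u' -> agree n v v' -> agree n (u ^ v) (u' ^ v').
Proof. by move=> uu vv; rewrite !conjgE; exact: agreeM (agreeV vv) (agreeM uu vv). Qed.

Lemma agreeW n m (u v : W) : m <= n -> agree n u v -> agree m u v.
Proof. by move=> mn uv t tm; apply: uv; apply: leq_trans mn. Qed.

Lemma agree0 (u v : W) : agree 0 u v.
Proof. by move=> [|//]; rewrite !aut_root. Qed.

Lemma agreeP (u v : W) : (forall n, agree n u v) -> u = v.
Proof. by move=> uv; apply: W_ext => t; apply: (uv (size t)). Qed.

Lemma agree_pair n (x y x' y' : W) :
  agree n x x' -> agree n y y' -> agree n.+1 (pairW x y) (pairW x' y').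
Proof. by move=> xx yy [|[] t] //= tn; rewrite ?xx ?yy. Qed.

Lemma agree_pair_inv n (x y x' y' : W) :
  agree n.+1 (pairW x y) (pairW x' y') -> agree n x x' /\ agree n y y'.
Proof.
move=> E; split=> t tn.
  by have /(congr1 (@behead bool)) := E (false :: t) tn.
by have /(congr1 (@behead bool)) := E (true :: t) tn.
Qed.

Lemma agree_leaf n s (x y : W) : agree n x y -> agree n.+1 (leaf s x) (leaf s y).
Proof. by case: s => xy; apply: agree_pair. Qed.

Lemma agree_swap n (x y : W) : agree n x y ->
  agree n.+1 (pairW x 1 * sigma) (pairW y 1 * sigma).
Proof. by move=> xy; apply: agreeM => //; apply: agree_pair. Qed.

(** The exponent of the level-[n] quotient divides [2 ^ n]: a square has the form [pairW x y], and
    each coordinate then acts on a tree one level shorter. *)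
Lemma agree_expg2n n (u : W) : agree n (u ^+ (2 ^ n)) 1.
Proof.
elim: n u => [|n IH] u; first exact: agree0.
have half (x y : W) : agree n.+1 (pairW x y ^+ (2 ^ n)) 1.
  suff -> m : pairW x y ^+ m = pairW (x ^+ m) (y ^+ m).
    by rewrite -pairW1; apply: agree_pair.
  by elim: m => [|m IHm]; rewrite ?pairW1 // !expgS IHm pairWM.
have [[x [y ->]]|[x [y ->]]] := W_cases u.
  rewrite expnS mulnC expgnA expg2.
  by have := agreeM (half x y) (half x y); rewrite mulg1.
rewrite expnS expgnA expg2 mulgA -(mulgA _ sigma) pairW_sigma mulgA pairWM.
by rewrite -mulgA sigma2 mulg1.
Qed.

(** The preimage in [W] of the image of [H] in Aut(T_n); it replaces computing in the finite
    quotient. *)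
Definition lev (n : nat) (H : set W) : set W :=
  [set u | exists2 h, H h & agree n u h].

Lemma lev_incl n (H : set W) : H `<=` lev n H.
Proof. by move=> h Hh; exists h. Qed.

Lemma lev_agree n (H : set W) u v : agree n u v -> lev n H v -> lev n H u.
Proof. by move=> uv [h Hh vh]; exists h => //; apply: agree_trans vh. Qed.

Lemma lev_subgroup n (H : set W) : subgroup H -> subgroup (lev n H).
Proof.
move=> [H1 HM HV]; split=> [|x y [h Hh xh] [k Hk yk]|x [h Hh xh]].
- exact: lev_incl.
- by exists (h * k); [apply: HM|apply: agreeM].
- by exists h^-1; [apply: HV|apply: agreeV].
Qed.

Lemma closureP (H : set W) u : closure H u <-> forall n, lev n H u.
Proof.
split=> [cu n|lu A [n _ nA]].
  have [|h [Hh uh]] := cu [set v | agree n u v]; first by exists n.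
  by exists h.
by have [h Hh uh] := lu n; exists h; split=> //; apply: nA.
Qed.

Lemma closure_subgroup (H : set W) : subgroup H -> subgroup (closure H).
Proof.
move=> sH; have sL n := lev_subgroup n sH; split=> [|x y|x].
- by apply/closureP => n; have [] := sL n.
- move=> /closureP cx /closureP cy; apply/closureP => n.
  by have [_ LM _] := sL n; apply: LM.
- by move=> /closureP cx; apply/closureP => n; have [_ _ LV] := sL n; apply: LV.
Qed.

(** * Finiteness of the levels, limits and compactness *)

Lemma levels_finite n : exists s : seq W, forall u, exists2 v, v \in s & agree n u v.
Proof.
elim: n => [|n [s sP]].
  by exists [:: 1] => u; exists 1; [rewrite inE|apply: agree0].
exists ([seq pairW x y | x <- s, y <- s] ++ [seq pairW x y * sigma | x <- s, y <- s]).
move=> u; case: (W_cases u) => -[x [y ->]];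
  have [x' sx xx] := sP x; have [y' sy yy] := sP y.
  exists (pairW x' y'); last exact: agree_pair.
  by rewrite mem_cat; apply/orP; left; apply/allpairsP; exists (x', y').
exists (pairW x' y' * sigma); last by apply: agreeM => //; apply: agree_pair.
by rewrite mem_cat; apply/orP; right; apply/allpairsP; exists (x', y').
Qed.

Lemma W_limit (u : nat -> W) :
  (forall n, agree n (u n) (u n.+1)) -> exists v, forall n, agree n (u n) v.
Proof.
move=> uS; have uD m n : m <= n -> agree m (u m) (u n).
  elim: n => [|n IH]; first by rewrite leqn0 => /eqP->.
  rewrite leq_eqVlt => /orP[/eqP->//|]; rewrite ltnS => mn.
  by apply: (agree_trans (IH mn)); apply: agreeW (uS n).
(* A word of length [n] is already moved in its final way by [u n]. *)
pose f t := u (size t) t.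
have fE n t : size t <= n -> f t = u n t by move=> tn; apply: uD.
have f_bij : bijective f.
  exists (fun t => (u (size t))^-1 t) => t; rewrite /f.
    by rewrite aut_size W_mulVK.
  by rewrite aut_size W_mulKV.
have f_root : f [::] = [::] by rewrite /f aut_root.
have f_edge s t : edge (f s) (f t) = edge s t.
  by rewrite !(fE (maxn (size s) (size t))) ?leq_maxl ?leq_maxr // aut_edge.
by exists (TreeAut f_bij f_root f_edge) => n t tn; rewrite /= -fE.
Qed.

(* Koenig's lemma on the tree of congruence classes. *)
Lemma W_compact (P : nat -> W -> Prop) :
  (forall n u v, agree n u v -> P n u -> P n v) ->
  (forall n u, P n.+1 u -> P n u) ->
  (forall n, exists u, P n u) -> exists u, forall n, P n u.
Proof.
move=> Pagree PS Pex.
have PD m n u : m <= n -> P n u -> P m u.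
  elim: n => [|n IH]; first by rewrite leqn0 => /eqP->.
  by rewrite leq_eqVlt => /orP[/eqP->//|]; rewrite ltnS => mn /PS; apply: IH.
(* The classes of level [n] that meet every [P m]; the infinite branch is built inside them. *)
pose ext n u := forall m, exists2 v, agree n u v & P m v.
have extS n u : ext n u -> exists u', agree n u u' /\ ext n.+1 u'.
  move=> eu; have [s sP] := levels_finite n.+1; apply: contrapT => no.
  (* If no refinement survives, every class of level [n.+1] within that of [u] misses some [P m]. As
     there are finitely many classes and [P] decreases, the largest such [m] contradicts
     [ext n u]. *)
  have {}no c : exists m, forall v, agree n u v -> agree n.+1 c v -> ~ P m v.
    apply: contrapT => nm; apply: no.
    have [v0 [uv0 cv0]] : exists v, agree n u v /\ agree n.+1 c v.
      apply: contrapT => nv; apply: nm; exists 0 => v uv cv; case: nv.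
      by exists v.
    exists c; split.
      by apply: (agree_trans uv0); apply/agree_sym; apply: agreeW cv0.
    move=> m; apply: contrapT => nv; apply: nm; exists m => v uv cv Pv.
    by apply: nv; exists v.
  have [mf mfP] := choice no.
  have [v uv Pv] := eu (\max_(c <- s) mf c).
  have [c cs vc] := sP v.
  apply: (mfP c v uv (agree_sym vc)).
  by apply: PD Pv; apply: leq_bigmax_seq.
have next_ex (p : nat * W) :
    exists v, ext p.1 p.2 -> agree p.1 p.2 v /\ ext p.1.+1 v.
  case: p => n u; have [/extS[v vP]|nu] := pselect (ext n u); first by exists v.
  by exists 1.
have [next nextP] := choice next_ex.
pose seq_u := fix g n := if n is n'.+1 then next (n', g n') else 1.
have seqP n : ext n (seq_u n).
  elim: n => [|n IH]; last by have [] := nextP (n, seq_u n) IH.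
  by move=> m; have [v Pv] := Pex m; exists v => //; apply: agree0.
have [v vP] : exists v, forall n, agree n (seq_u n) v.
  by apply: W_limit => n; have [] := nextP (n, seq_u n) (seqP n).
exists v => n; have [v' uv Pv] := seqP n n.
by apply: Pagree Pv; apply: agree_trans (vP n); apply: agree_sym.
Qed.

(** * Reordering products, and the diagonal *)

Lemma subgroup_prod (G : groupType) (H : set G) m n (F : nat -> G) :
  subgroup H -> (forall j, (m <= j < n)%N -> H (F j)) ->
  H (\prod_(m <= j < n) F j).
Proof.
by case=> H1 HM _ HF; rewrite big_nat; apply: big_ind.
Qed.

Definition generators (G : groupType) (r : nat) (c : nat -> G) : set G :=
  [set c i | i in [set i : nat | (1 <= i <= r)%N]].

Lemma generated_family (G : groupType) r (c : nat -> G) i :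
  (1 <= i <= r)%N -> generated (generators r c) (c i).
Proof. by move=> ir; apply: generated_incl; exists i. Qed.

Lemma generated_family_min (G : groupType) r (c : nat -> G) (H : set G) :
  subgroup H -> (forall i, (1 <= i <= r)%N -> H (c i)) ->
  generated (generators r c) `<=` H.
Proof. by move=> sH Hc; apply: generated_min => // _ [i ir <-]; apply: Hc. Qed.

(* Moving a factor [c j] with [s j] leftwards past the factors without [s] and
   past [c r] conjugates it by unmoved factors, which are common to both
   families. *)
Lemma reorder_product (G : groupType) (r : nat) (s : nat -> bool) (c : nat -> G)
    (r_gt0 : (1 <= r)%N) :
  exists c' : nat -> G,
  [/\ c' r = c r,
      (\prod_(1 <= j < r) c' j) * c r =
        (\prod_(1 <= j < r) (if s j then 1 else c j)) * c r *
        \prod_(1 <= j < r) (if s j then c j else 1)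
    & forall j, (1 <= j <= r)%N -> exists k,
        [/\ generated (generators r c) k, generated (generators r c') k
          & c' j = c j ^ k]].
Proof.
pose P m := \prod_(m <= j < r) (if s j then 1 else c j).
pose Q m := \prod_(m <= j < r) (if s j then c j else 1).
pose c' j := if s j && (j < r)%N then c j ^ (P j.+1 * c r)^-1 else c j.
have c'r : c' r = c r by rewrite /c' ltnn andbF.
exists c'; split=> // [|j /andP[j1 jr]].
  suff H d m : (r - m = d)%N -> (\prod_(m <= j < r) c' j) * c r = P m * c r * Q m.
    exact: H.
  elim: d m => [|d IH] m rm.
    by rewrite /P /Q !big_geq ?mul1g ?mulg1 // -subn_eq0 rm.
  have mr : (m < r)%N by rewrite -subn_gt0 rm.
  rewrite /P /Q !(big_ltn mr) -/(P m.+1) -/(Q m.+1) -mulgA IH ?subnS ?rm //.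
  rewrite /c' mr andbT; case: (s m); last by rewrite mul1g !mulgA.
  by rewrite mul1g conjgE invgK; move: (P m.+1 * c r) => x; rewrite -!mulgA mulKg.
(* The conjugator is built from [c r] and unmoved factors only. It is applied to both generated
   subgroups, since these factors are the same in [c] and [c']. *)
have PH (H : set G) : subgroup H -> H (c r) ->
    (forall i, (1 <= i < r)%N -> ~~ s i -> H (c i)) -> H (P j.+1 * c r).
  move=> sH Hr Hc; have [H1 HM _] := sH; apply: HM => //.
  apply: subgroup_prod => // i /andP[ji ir]; case: ifPn => // si.
  by apply: Hc si; rewrite ir (leq_trans _ ji).
have [sj|sj] := boolP (s j && (j < r)%N); last first.
  exists 1; split; last by rewrite conjg1 /c' (negbTE sj).
    by have [] := generated_subgroup (generators r c).
  by have [] := generated_subgroup (generators r c').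
exists (P j.+1 * c r)^-1; split; last by rewrite /c' sj.
  have [_ _ HV] := generated_subgroup (generators r c); apply: HV.
  apply: (PH (generated (generators r c))) => [||i ir _].
  - exact: generated_subgroup.
  - by apply: generated_family; rewrite r_gt0 leqnn.
  - by apply: generated_family; case/andP: ir => -> /ltnW.
have [_ _ HV] := generated_subgroup (generators r c'); apply: HV.
apply: (PH (generated (generators r c'))) => [||i ir si].
- exact: generated_subgroup.
- by rewrite -c'r; apply: generated_family; rewrite r_gt0 leqnn.
- have <- : c' i = c i by rewrite /c' (negbTE si).
  by apply: generated_family; case/andP: ir => -> /ltnW.
Qed.

Lemma leaf_both (H : set W) s c x :
  subgroup H -> H (pairW x 1 * sigma) -> H (leaf s c) ->
  H (pairW c 1) /\ H (pairW 1 c).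
Proof.
move=> sH Ht; have [_ _ HV] := sH.
have E : pairW 1 c ^ (pairW x 1 * sigma) = pairW c 1 := leaf_swapJ true c x.
case: s => /= Hc; split=> //; first by rewrite -E; apply: subgroupJ.
by rewrite -(conjgK (pairW x 1 * sigma) (pairW 1 c)) E; apply: subgroupJ => //; apply: HV.
Qed.

(** The square of [pairW (c r) 1 * sigma] is [pairW (c r) (c r)], and conjugation by this same
    element exchanges the two sides of a leaf up to inner conjugation, so that [H] contains both
    [pairW (c j) 1] and [pairW 1 (c j)]. *)
Lemma diagonal_subgroup (H : set W) r (s : nat -> bool) (c : nat -> W) :
  (1 <= r)%N -> subgroup H -> H (pairW (c r) 1 * sigma) ->
  (forall j, (1 <= j < r)%N -> H (leaf (s j) (c j))) ->
  forall g, generated (generators r c) g -> H (pairW g g).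
Proof.
move=> r_gt0 sH Ht Hc; have [H1 HM HV] := sH; apply: generated_family_min.
  split=> [|x y Hx Hy|x Hx] /=; first by rewrite pairW1.
    by rewrite -pairWM; apply: HM.
  by rewrite -pairWV; apply: HV.
move=> i /andP[i1]; rewrite leq_eqVlt => /orP[/eqP->|ir] /=.
  have -> : pairW (c r) (c r) = (pairW (c r) 1 * sigma) * (pairW (c r) 1 * sigma).
    by rewrite mulgA -(mulgA _ sigma) pairW_sigma mulgA pairWM -mulgA sigma2 !mulg1 mul1g.
  exact: HM.
have [|c1 c2] := leaf_both sH Ht (Hc i _); first by rewrite i1.
by have := HM _ _ c1 c2; rewrite pairWM mulg1 mul1g.
Qed.

Lemma prod_leaf (s : nat -> bool) (c : nat -> W) m n :
  \prod_(m <= j < n) leaf (s j) (c j) =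
  pairW (\prod_(m <= j < n) (if s j then 1 else c j))
        (\prod_(m <= j < n) (if s j then c j else 1)).
Proof.
elim/big_rec3: _ => [|j x y z _ ->]; first by rewrite pairW1.
by case: (s j); rewrite pairWM mul1g.
Qed.

(** Moving [sigma] from the first factor to the far right swaps the coordinates of all the leaves,
    so the factors with [s j] end up on the left. *)
Lemma prod_swap_leaf r (s : nat -> bool) (b c : nat -> W) : (1 <= r)%N ->
  b 1%N = pairW (c r) 1 * sigma ->
  (forall j, (1 <= j < r)%N -> b j.+1 = leaf (s j) (c j)) ->
  \prod_(1 <= i < r.+1) b i =
  pairW (c r * \prod_(1 <= j < r) (if s j then c j else 1))
        (\prod_(1 <= j < r) (if s j then 1 else c j)) * sigma.
Proof.
move=> r_gt0 b1 bS; rewrite big_ltn // big_add1 b1 /=.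
rewrite (eq_big_nat _ _ bS) prod_leaf -mulgA pairW_sigma mulgA pairWM.
by rewrite mul1g.
Qed.

(** * Simultaneous conjugacy at finite levels *)

Section Generators.

Context (r : nat) (a : nat -> W).
Context (r_gt0 : (1 <= r)%N) (aP : generators_recursion r a)
  (a0P : zeroth_is_product r a).

Let A := generated (generators r a).
Let q := \prod_(1 <= j < r) a j.

Let A_subgroup : subgroup A := generated_subgroup _.

Lemma a1E : a 1%N = pairW (a r) 1 * sigma. Proof. by case: aP. Qed.

Lemma aSE j : (1 <= j < r)%N -> a j.+1 = pairW (a j) 1.
Proof. by case: aP => _ E jr; rewrite E. Qed.

(** Here all leaves are on the left, so [a 0] is [pairW (a r) q * sigma], and [q * a r] is again
    [a 0]: up to conjugacy [a 0] satisfies the recursion of the odometer. *)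
Lemma a0E : a 0%N = (pairW (a 0%N) 1 * sigma) ^ pairW q 1.
Proof.
have a0q : a 0%N = q * a r by rewrite a0P big_nat_recr.
rewrite {2}a0q -swap_normal a0P (prod_swap_leaf (s := fun=> false) r_gt0 a1E aSE).
by rewrite big1 // mulg1.
Qed.

Lemma A_gen i : (1 <= i <= r)%N -> A (a i).
Proof. exact: generated_family. Qed.

Lemma A_swap : A (pairW (a r) 1 * sigma).
Proof. by rewrite -a1E; apply: (A_gen (i := 1)); rewrite r_gt0. Qed.

Lemma A_leaf j : (1 <= j < r)%N -> A (pairW (a j) 1) /\ A (pairW 1 (a j)).
Proof.
move=> jr; apply: (leaf_both (s := false) A_subgroup A_swap).
by rewrite -[leaf _ _]/(pairW (a j) 1) -aSE //; apply: (A_gen (i := j.+1)); case/andP: jr.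
Qed.

Lemma A_diag g : A g -> A (pairW g g).
Proof.
apply: (diagonal_subgroup (s := fun=> false) r_gt0 A_subgroup A_swap).
by move=> j /A_leaf[].
Qed.

Lemma A_pair_subgroup : subgroup [set p | A (pairW p 1)].
Proof.
have [A1 AM AV] := A_subgroup; split=> [|x y Ax Ay|x Ax] /=.
- by rewrite pairW1.
- by rewrite -[1]mulg1 -pairWM; apply: AM.
- by rewrite -[1]invg1 -pairWV; apply: AV.
Qed.

Lemma A_pairJ p k : A (pairW p 1) -> A k -> A (pairW (p ^ k) 1).
Proof.
by move=> Ap /A_diag Ak; rewrite -(conj1g k) -pairWJ; apply: (subgroupJ A_subgroup).
Qed.

Lemma A_q : A (pairW q 1).
Proof. by apply: (subgroup_prod A_pair_subgroup) => j /A_leaf[]. Qed.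

(** Condition (c) modulo level [n], where the closure of [A] may be replaced by [A] itself. The last
    clause is the reverse inclusion between generated groups, from which the closed subgroup
    generated by the [b i] is identified. *)
Definition rigid_modulo (n : nat) (b : nat -> W) (w : W) : Prop :=
  [/\ forall i, (1 <= i <= r)%N ->
        exists2 k, A k & agree n (b i) ((a i ^ k) ^ w),
      exists2 k, A k &
        agree n (\prod_(1 <= i < r.+1) b i) ((a 0%N ^ k) ^ w)
    & forall i, (1 <= i <= r)%N -> lev n (generated (generators r b)) (a i ^ w)].

(** Condition (b) with the product in place of [b 0], so that it can be applied to the auxiliary
    families of the induction. *)
Definition conjugate_family (b : nat -> W) : Prop :=
  (forall i, (1 <= i <= r)%N -> exists g, b i = a i ^ g) /\
  (exists g, \prod_(1 <= i < r.+1) b i = a 0%N ^ g).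

Lemma family_prodJ (b : nat -> W) z :
  \prod_(1 <= i < r.+1) (b i ^ z) = (\prod_(1 <= i < r.+1) b i) ^ z.
Proof. by rewrite conjg_prod. Qed.

Lemma rigid_moduloJ n b w z :
  rigid_modulo n (fun i => b i ^ z) w -> rigid_modulo n b (w * z^-1).
Proof.
case=> H1 [k0 Ak0 H2] H3; split=> [i /H1[k Ak bk]||i /H3[h Hh ah]].
- exists k => //; rewrite conjgM -(conjgK z (b i)).
  by apply: agreeJ.
- exists k0 => //; rewrite conjgM -[X in agree _ X](conjgK z) -family_prodJ.
  by apply: agreeJ.
- exists (h ^ z^-1); last by rewrite conjgM; apply: agreeJ.
  have sH := subgroup_preimJ z^-1 (generated_subgroup (generators r b)).
  apply: (generated_family_min sH) Hh => j jr /=.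
  by rewrite conjgK; apply: generated_family.
Qed.

(* Undoing the reordering costs only conjugation by elements of the common
   generated subgroup. *)
Lemma rigid_modulo_reorder n (c c' : nat -> W) w :
  (forall j, (1 <= j <= r)%N -> exists k,
     [/\ generated (generators r c) k, generated (generators r c') k
       & c' j = c j ^ k]) ->
  rigid_modulo n c' w ->
  [/\ forall i, (1 <= i <= r)%N ->
        exists2 k, A k & agree n (c i) ((a i ^ k) ^ w)
    & forall i, (1 <= i <= r)%N -> lev n (generated (generators r c)) (a i ^ w)].
Proof.
move=> cc' [H1 _ H3].
have gen'A : generated (generators r c') `<=` [set h | lev n A (h ^ w^-1)].
  apply: generated_family_min => [|i ir] /=.
    exact/subgroup_preimJ/lev_subgroup.
  have [k Ak ck] := H1 i ir.
  exists (a i ^ k); first exact: subgroupJ A_subgroup (A_gen ir) Ak.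
  by rewrite -[X in agree _ _ X](conjgK w); apply: agreeJ.
split=> [i ir|i /H3[h Hh ah]].
  (* The reordering conjugator [k] is [l ^ w] modulo level [n] with [l] in [A]; undoing it replaces
     [m] by [m * l^-1]. *)
  have [k [_ /gen'A[l Al kl] cik]] := cc' i ir; have [m Am c'm] := H1 i ir.
  exists (m * l^-1); first by have [_ AM AV] := A_subgroup; exact: AM Am (AV _ Al).
  rewrite -(conjgK k (c i)) -cik conjgM (conjJg (a i ^ m)) conjVg.
  apply: agreeJ => //; apply: agreeV.
  by rewrite -(conjgKV w k); apply: agreeJ.
exists h => //; move: h Hh {ah}.
apply: (generated_family_min (H := generated (generators r c))) => [|j jr].
  exact: generated_subgroup.
have [k [Hk _ ->]] := cc' j jr.
exact: subgroupJ (generated_subgroup _) (generated_family (c := c) jr) Hk.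
Qed.

(** One conjugation normalizes [b 1]; the other members stay conjugate to [pairW (a j) 1], and hence
    are leaves whatever the conjugator. *)
Lemma conjugate_family_normal (b : nat -> W) : conjugate_family b ->
  exists z s c,
  [/\ b 1%N ^ z = pairW (c r) 1 * sigma,
      forall j, (1 <= j < r)%N -> b j.+1 ^ z = leaf (s j) (c j)
    & forall j, (1 <= j <= r)%N -> exists g, c j = a j ^ g].
Proof.
case=> ba _; have [|x [y [b1E yx]]] := @conj_swap (b 1%N) (a r).
  by have [|g] := ba 1%N; rewrite ?r_gt0 // a1E; exists g.
pose z := (pairW y 1)^-1.
have leaves j : exists p : bool * W, (1 <= j < r)%N ->
    b j.+1 ^ z = leaf p.1 p.2 /\ exists g, p.2 = a j ^ g.
  have [jr|] := boolP (1 <= j < r)%N; last by exists (false, 1).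
  have [|s [c sc]] := @conj_leaf (b j.+1 ^ z) (a j); last by exists (s, c).
  have [|g ->] := ba j.+1; first by case/andP: jr.
  by rewrite aSE //; exists (g * z); rewrite conjgM.
have [f fP] := choice leaves.
exists z, (fun j => (f j).1), (fun j => if j == r then y * x else (f j).2).
split=> [|j jr|j /andP[j1 jr]].
- by rewrite eqxx b1E swap_normal conjgK.
- by have [-> _] := fP j jr; rewrite ltn_eqF //; case/andP: jr.
- case: eqP => [->//|/eqP jr']; apply: (fP j _).2.
  by rewrite j1 ltn_neqAle jr'.
Qed.

Lemma rigid_modulo_step n (b : nat -> W) (s : nat -> bool) (c : nat -> W) :
  (forall c', conjugate_family c' -> exists w, rigid_modulo n c' w) ->
  conjugate_family b ->
  b 1%N = pairW (c r) 1 * sigma ->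
  (forall j, (1 <= j < r)%N -> b j.+1 = leaf (s j) (c j)) ->
  (forall j, (1 <= j <= r)%N -> exists g, c j = a j ^ g) ->
  exists w, rigid_modulo n.+1 b w.
Proof.
move=> IH [_ b0a] b1 bS ca.
have [c' [c'r c'0 c'P]] := reorder_product s c r_gt0.
set P := \prod_(1 <= j < r) (if s j then 1 else c j) in c'0.
set Q := \prod_(1 <= j < r) (if s j then c j else 1) in c'0.
have b0 : \prod_(1 <= i < r.+1) b i = pairW (c r * Q) P * sigma.
  exact: prod_swap_leaf.
have b0' : \prod_(1 <= i < r.+1) b i = (pairW (P * c r * Q) 1 * sigma) ^ pairW P 1.
  by rewrite b0 swap_normal mulgA.
have c'0E : \prod_(1 <= j < r.+1) c' j = P * c r * Q.
  by rewrite big_nat_recr //= c'r.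
have [|w wP] := IH c'.
  split=> [j jr|].
    have [k [_ _ ->]] := c'P j jr; have [g ->] := ca j jr.
    by exists (g * k); rewrite conjgM.
  (* The product of the [b i] is conjugate to [pairW (a 0) 1 * sigma], so its invariant from
     [conj_swap], here [P * c r * Q], is conjugate to [a 0]. *)
  rewrite c'0E; have [|x [y []]] := @conj_swap (\prod_(1 <= i < r.+1) b i) (a 0%N).
    by have [g ->] := b0a; exists (pairW q 1 * g); rewrite conjgM -a0E.
  rewrite b0 => /mulIg/pairW_inj[<- <-].
  by rewrite mulgA.
have [_ c'0k _] := wP.
have [ck aw] := rigid_modulo_reorder c'P wP.
pose H := generated (generators r b).
have sH : subgroup H by exact: generated_subgroup.
have Hb i : (1 <= i <= r)%N -> H (b i) by exact: generated_family.
have H1 : H (pairW (c r) 1 * sigma) by rewrite -b1; apply: (Hb 1%N); rewrite r_gt0.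
have HS j : (1 <= j < r)%N -> H (leaf (s j) (c j)).
  by move=> jr; rewrite -bS //; apply: (Hb j.+1); case/andP: jr.
have Hdiag := diagonal_subgroup r_gt0 sH H1 HS.
have gen_w k : A k -> exists2 h, generated (generators r c) h & agree n (k ^ w) h.
  move: k; apply: (generated_family_min
    (H := [set k | lev n (generated (generators r c)) (k ^ w)])) => //.
  exact/subgroup_preimJ/lev_subgroup/generated_subgroup.
have aw_c j : (1 <= j <= r)%N ->
    exists2 h, generated (generators r c) h & agree n (a j ^ w) (c j ^ h).
  move=> jr; have [k /gen_w[h Hh kh] cjk] := ck j jr; exists h^-1.
    by have [_ _ HV] := generated_subgroup (generators r c); apply: HV.
  rewrite -(conjgK k (a j)) (conjJg (a j ^ k)) conjVg.
  apply: agreeJ; first exact: agree_sym.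
  exact: agreeV.
exists (pairW w w); split=> [i /andP[i1 ir]||i /andP[i1 ir]].
- case: i i1 ir => // -[|j] _ jr.
    have [k Ak ckr] : exists2 k, A k & agree n (c r) ((a r ^ k) ^ w).
      by apply: ck; rewrite r_gt0 leqnn.
    exists (pairW k k); first exact: A_diag.
    by rewrite b1 a1E !swapJ_diag; apply: agree_swap.
  have [k Ak cjk] : exists2 k, A k & agree n (c j.+1) ((a j.+1 ^ k) ^ w).
    by apply: ck; rewrite /= ltnW.
  (* A leaf on the right is brought to the left by conjugation with [a 1], which lies in [A]. *)
  have [t At tE] : exists2 t, A t & leaf (s j.+1) (a j.+1) = a j.+2 ^ t.
    rewrite (aSE (j := j.+1)) //; case: (s j.+1); last first.
      by exists 1; [case: A_subgroup|rewrite conjg1].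
    exists (a 1%N)^-1.
      have [_ _ AV] := A_subgroup; apply: (AV (a 1%N)).
      by apply: (A_gen (i := 1)); rewrite r_gt0.
    rewrite a1E; have <- := leaf_swapJ true (a j.+1) (a r).
    by rewrite conjgK.
  exists (t * pairW k k).
    by have [_ AM _] := A_subgroup; exact: AM At (A_diag Ak).
  by rewrite conjgM -tE !leafJ bS //; apply: agree_leaf.
(* Each factor of [P] is [(a j ^ k) ^ w] modulo level [n], and [A] contains [pairW (a j ^ k) 1]
   because it contains the diagonal of [k]. *)
- have [p Ap Pp] : exists2 p, A (pairW p 1) & agree n P (p ^ w).
    rewrite /P big_nat; elim/big_rec: _ => [|j x jr [p Ap xp]].
      by exists 1; rewrite ?pairW1 ?conj1g //; case: A_subgroup.
    case: (s j); first by exists p; rewrite ?mul1g.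
    have [|k Ak cjk] := ck j; first by case/andP: jr => -> /ltnW.
    exists (a j ^ k * p); last by rewrite conjMg; apply: agreeM.
    have [_ AM _] := A_pair_subgroup; apply: AM Ap.
    by apply: A_pairJ => //; have [] := A_leaf jr.
  have [k Ak c'k] := c'0k.
  (* Undo the normalization of [a 0], apply the level-[n] conjugator diagonally, then restore the
     normalization of the product of the [b i], where [p ^ w] stands for [P]. *)
  exists ((pairW q 1)^-1 * pairW k k * pairW p 1).
    have [_ AM AV] := A_subgroup.
    exact: AM (AM _ _ (AV _ A_q) (A_diag Ak)) Ap.
  rewrite !conjgM a0E conjgK swapJ_diag conjJg swapJ_diag pairWJ conj1g b0'.
  apply: agreeJ; last exact: agree_pair.
  by apply: agree_swap; rewrite -c'0E.
- case: i i1 ir => // -[|j] _ jr.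
    have [|h Hh arh] := aw_c r; first by rewrite r_gt0 leqnn.
    exists ((pairW (c r) 1 * sigma) ^ pairW h h).
      exact: subgroupJ sH H1 (Hdiag _ Hh).
    by rewrite a1E !swapJ_diag; apply: agree_swap.
  have [|h Hh ajh] := aw_c j.+1; first by rewrite /= ltnW.
  exists (pairW (c j.+1) 1 ^ pairW h h).
    have [cj _] := leaf_both sH H1 (HS j.+1 jr).
    exact: subgroupJ sH cj (Hdiag _ Hh).
  by rewrite aSE // !pairWJ !conj1g; apply: agree_pair.
Qed.

Lemma rigid_modulo_exists n (b : nat -> W) :
  conjugate_family b -> exists w, rigid_modulo n b w.
Proof.
elim: n b => [|n IH] b ba.
  exists 1; split=> [i _||i _].
  - by exists 1; [case: A_subgroup|apply: agree0].
  - by exists 1; [case: A_subgroup|apply: agree0].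
  - by exists 1; [case: (generated_subgroup (generators r b))|apply: agree0].
have [z [s [c [b1 bS ca]]]] := conjugate_family_normal ba.
have bza : conjugate_family (fun i => b i ^ z).
  split=> [i /ba.1[g ->]|]; first by exists (g * z); rewrite conjgM.
  by rewrite family_prodJ; have [g ->] := ba.2; exists (g * z); rewrite conjgM.
have [w /rigid_moduloJ wP] :=
  rigid_modulo_step (b := fun i => b i ^ z) IH bza b1 bS ca.
by exists (w * z^-1).
Qed.

End Generators.

(** * Conjugacy in the limit, and the centralizer of the odometer *)

Lemma conj_compact (x y : W) :
  (forall n, exists w, agree n x (y ^ w)) -> exists w, x = y ^ w.
Proof.
move=> xy; have [|n u uP|//|w wP] := W_compact (P := fun n w => agree n x (y ^ w)).
- by move=> n u v uv xu; apply: (agree_trans xu); apply: agreeJ.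
- exact: agreeW uP.
- by exists w; apply: agreeP.
Qed.

Lemma subgroupX (G : groupType) (H : set G) x k :
  subgroup H -> H x -> H (x ^+ k).
Proof.
by case=> H1 HM _ Hx; elim: k => [|k IH]; rewrite ?expg0 // expgS; apply: HM.
Qed.

(** Replace [d] by its conjugate [e = pairW d 1 * sigma]. If [pairW x y] commutes with [e] modulo
    level [n.+1], then [y] agrees with [x] and [x] commutes with [d] modulo level [n]. So [x] is a
    power [d ^+ k] there, and [pairW (d ^+ k) (d ^+ k)] is [e ^+ (2 * k)]. *)
Lemma odometer_centralizer (d : W) :
  (exists g, d = (pairW d 1 * sigma) ^ g) ->
  forall n u, agree n (u * d) (d * u) -> exists k, agree n u (d ^+ k).
Proof.
case=> g dE; elim=> [|n IH] u ud; first by exists 0; apply: agree0.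
pose e := pairW d 1 * sigma.
have pair_case x y : agree n.+1 (pairW x y * e) (e * pairW x y) ->
    exists k, agree n.+1 (pairW x y) (e ^+ (2 * k)).
  rewrite /e mulgA -(mulgA _ sigma) pairW_sigma mulgA !pairWM mulg1 mul1g.
  move=> /agreeM/(_ (agree_refl sigma)); rewrite -!mulgA sigma2 !mulg1.
  case/agree_pair_inv => xd yx.
  have [|k xk] := IH x.
    by apply: (agree_trans xd); apply: agreeM.
  exists k; rewrite expgnA expg2 mulgA -(mulgA _ sigma) pairW_sigma.
  rewrite mulgA pairWM -mulgA sigma2 mulg1 mul1g mulg1.
  have -> : pairW d d ^+ k = pairW (d ^+ k) (d ^+ k).
    by elim: (k) => [|m IHm]; rewrite ?pairW1 // !expgS IHm pairWM.
  by apply: agree_pair => //; apply: agree_trans xk.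
suff [k uk] : exists k, agree n.+1 (u ^ g^-1) (e ^+ k).
  exists k; rewrite dE -conjXg -[u](conjgKV g); exact: agreeJ.
have : agree n.+1 (u ^ g^-1 * e) (e * u ^ g^-1).
  by rewrite -[e](conjgK g) -dE -!conjMg; apply: agreeJ.
case: (W_cases (u ^ g^-1)) => -[x [y ->]].
  by move=> /pair_case[k xk]; exists (2 * k)%N.
(* An element swapping the halves is reduced to the previous case by splitting off one factor [e],
   which makes the exponent odd. *)
have -> : pairW x y * sigma = pairW (x * d^-1) y * e.
  by rewrite /e mulgA pairWM mulgVK mulg1.
move=> ve; have [|k vk] := pair_case (x * d^-1) y.
  by have := agreeM ve (agree_refl e^-1); rewrite mulgK (mulgA e) mulgK.
by exists (2 * k).+1; rewrite expgSr; apply: agreeM.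
Qed.

(** * Passage to the limit *)

Section Main.

Context (r : nat) (a b : nat -> W).
Context (r_gt0 : (1 <= r)%N) (aP : generators_recursion r a)
  (a0P : zeroth_is_product r a) (b0P : zeroth_is_product r b).

Let A := generated (generators r a).
Let A_subgroup : subgroup A := generated_subgroup _.
Let G := closure A.
Let G_subgroup : subgroup G := closure_subgroup A_subgroup.

Let A_all i : (i <= r)%N -> A (a i).
Proof.
case: i => [_|i ir]; last exact: generated_family.
rewrite a0P; apply: (subgroup_prod A_subgroup) => j jr.
by apply: (generated_family (c := a)).
Qed.

Lemma conjugate_familyP :
  conjugate_family r a b <-> forall i, (i <= r)%N -> exists g, b i = a i ^ g.
Proof.
split=> [[ba b0a] [|i] ir|ba]; last first.
- by split=> [i /andP[_ ir]|]; [apply: ba|rewrite -b0P; apply: ba].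
- exact: ba.
- by rewrite b0P.
Qed.

Let recursive :=
  [/\ exists g, b 0%N = (pairW (b 0%N) 1 * sigma) ^ g,
      exists g, b 1%N = (pairW (b r) 1 * sigma) ^ g
    & forall i, (2 <= i <= r)%N -> exists g, b i = pairW (b i.-1) 1 ^ g].

Lemma recursive_of_conjugate :
  (forall i, (i <= r)%N -> exists g, b i = a i ^ g) -> recursive.
Proof.
have sym (x y : W) : (exists g, x = y ^ g) -> exists g, y = x ^ g.
  by move=> [g ->]; exists g^-1; rewrite conjgK.
move=> ba; split=> [||[//|[//|i]] ir].
- apply: conjg_trans (ba 0%N isT) _; rewrite (a0E r_gt0 aP a0P).
  apply: conjg_trans (swap_conj (sym _ _ (ba 0%N isT))).
  by eexists.
- apply: conjg_trans (ba 1%N r_gt0) _; rewrite (a1E aP).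
  exact: swap_conj (sym _ _ (ba r (leqnn r))).
- apply: conjg_trans (ba i.+2 ir) _; rewrite (aSE aP) //.
  exact: pair_conj (sym _ _ (ba i.+1 (ltnW ir))).
Qed.

(** Each relation turns conjugacy modulo level [n] on its right-hand side into conjugacy modulo
    level [n.+1] on its left. So the induction is on the level, for all [i] together, and the cycle
    through the indices does no harm. *)
Lemma conjugate_of_recursive :
  recursive -> forall i, (i <= r)%N -> exists g, b i = a i ^ g.
Proof.
case=> [[g0 b0] [g1 b1] bS] i ir; apply: conj_compact => n.
elim: n i ir => [|n IH] i ir; first by exists 1; apply: agree0.
case: i ir => [|[|i]] ir.
- have [g bg] := IH 0%N isT; pose q := \prod_(1 <= j < r) a j.
  exists ((pairW q 1)^-1 * pairW g g * g0).
  rewrite !conjgM (a0E r_gt0 aP a0P) conjgK swapJ_diag b0.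
  by apply: agreeJ => //; apply: agree_swap.
- have [g bg] := IH r (leqnn r).
  exists (pairW g g * g1); rewrite conjgM (a1E aP) swapJ_diag b1.
  by apply: agreeJ => //; apply: agree_swap.
- have [g bg] := IH i.+1 (ltnW ir); have [|h ->] := bS i.+2; first by rewrite ir.
  exists (pairW g g * h); rewrite conjgM (aSE aP) // pairWJ conj1g.
  by apply: agreeJ => //; apply: agree_pair.
Qed.

Lemma simultaneous_of_conjugate :
  (forall i, (i <= r)%N -> exists g, b i = a i ^ g) ->
  exists w, forall i, (i <= r)%N -> exists2 k, G k & b i = (a i ^ k) ^ w.
Proof.
move=> /conjugate_familyP ba.
pose P n w := forall i, (i <= r)%N ->
  exists2 k, A k & agree n (b i) ((a i ^ k) ^ w).
have [|||w wP] := W_compact (P := P).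
- move=> n u v uv Pu i /Pu[k Ak bk]; exists k => //.
  by apply: (agree_trans bk); apply: agreeJ.
- by move=> n u Pu i /Pu[k Ak bk]; exists k => //; apply: agreeW bk.
- move=> n; have [w [H1 H0 _]] := rigid_modulo_exists r_gt0 aP a0P n ba.
  by exists w => -[_|i ir]; [rewrite b0P|apply: H1].
exists w => i ir.
(* A second compactness argument, for fixed [w] and [i]: the conjugators found in [A] vary with the
   level. Recording closeness to [A] puts their limit in the closure [G]. *)
pose Q n x := exists2 k, A k & agree n x k /\ agree n (b i) ((a i ^ x) ^ w).
have [|||k kP] := W_compact (P := Q).
- move=> n u v uv [k Ak [uk bu]]; exists k => //; split.
    exact: agree_trans (agree_sym uv) uk.
  by apply: (agree_trans bu); apply: agreeJ => //; apply: agreeJ.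
- move=> n u [k Ak [uk bu]]; exists k => //.
  by split; [apply: agreeW uk|apply: agreeW bu].
- by move=> n; have [k Ak bk] := wP n i ir; exists k, k.
exists k; last by apply: agreeP => n; have [? _ []] := kP n.
by apply/closureP => n; have [l Al []] := kP n; exists l.
Qed.

(** One inclusion is direct. For the other, [rigid_modulo] gives at each level some [w1], perhaps
    unrelated to [w], that conjugates [A] into [B]. Then [w1 * w^-1] conjugates [A] into itself
    modulo the level, and so does its inverse; now [g ^ w] is [(g ^ (w * w1^-1)) ^ w1]. *)
Lemma generated_of_simultaneous (w : W) :
  (forall i, (i <= r)%N -> exists2 k, G k & b i = (a i ^ k) ^ w) ->
  closure (generated [set b i | i in [set i : nat | (i <= r)%N]]) =
    [set g ^ w | g in G].
Proof.
move=> bw; set B := generated _.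
have sB : subgroup B by exact: generated_subgroup.
have BG : B `<=` [set u | G (u ^ w^-1)].
  apply: generated_min => [|_ [i ir <-] /=]; first exact: subgroup_preimJ.
  have [k Gk ->] := bw i ir; rewrite conjgK.
  apply: (subgroupJ G_subgroup) => //.
  by apply/closureP => n; apply: lev_incl; apply: A_all.
have GlevA n g : G g -> lev n A g by move=> /closureP.
apply/seteqP; split=> [u /closureP uB|_ [g Gg <-]].
  exists (u ^ w^-1); last exact: conjgKV.
  apply/closureP => n; have [h /BG/(GlevA n) hA uh] := uB n.
  by apply: lev_agree hA; apply: agreeJ.
apply/closureP => n.
have [w1 [_ _ aw1]] : exists w1, rigid_modulo r a n b w1.
  apply: rigid_modulo_exists => //; apply/conjugate_familyP => i /bw[k _ ->].
  by exists (k * w); rewrite conjgM.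
have lev_w1 k : lev n A k -> lev n B (k ^ w1).
  suff AB : A `<=` [set k | lev n B (k ^ w1)].
    move=> [k' /AB kB kk]; apply: lev_agree kB; exact: agreeJ.
  apply: generated_family_min => [|i /aw1[h Hh ah]] /=.
    exact/subgroup_preimJ/lev_subgroup.
  exists h => //; move: h Hh {ah}; apply: (generated_family_min (H := B)) => //.
  by move=> j /andP[_ jr]; apply: generated_incl; exists j.
pose u := w1 * w^-1.
have levJ k : lev n A k -> lev n A (k ^ u).
  move=> /lev_w1[h /BG/(GlevA n) hA kh]; rewrite conjgM.
  by apply: lev_agree hA; apply: agreeJ.
have levX m k : lev n A k -> lev n A (k ^ (u ^+ m)).
  elim: m k => [|m IH] k Ak; first by rewrite expg0 conjg1.
  by rewrite expgS conjgM; apply/IH/levJ.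
(* modulo level [n], [u] has finite order, so [u^-1] normalizes as well *)
have uV : agree n u^-1 (u ^+ (2 ^ n).-1).
  have := agreeM (agree_refl u^-1) (agree_sym (@agree_expg2n n u)).
  by rewrite mulg1 -{1}(prednK (expn_gt0 2 n)) expgS mulKg.
have : lev n A (g ^ u^-1).
  by apply: lev_agree (levX (2 ^ n).-1 g (GlevA n g Gg)); apply: agreeJ.
by move=> /lev_w1; rewrite -conjgM /u invgM invgK mulgVK.
Qed.

(** The two conjugators [k * w] and [k' * w'] of [a 0] differ by an element centralizing [a 0]. At
    every level this is a power of [a 0], so it lies in [G]. *)
Lemma simultaneous_unique (w w' : W) :
  (exists2 k, G k & b 0%N = (a 0%N ^ k) ^ w) ->
  (exists2 k, G k & b 0%N = (a 0%N ^ k) ^ w') -> G (w * w'^-1).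
Proof.
move=> [k Gk bk] [k' Gk' bk']; have [_ GM GV] := G_subgroup.
pose u := k * w * (k' * w')^-1.
have au : a 0%N ^ u = a 0%N.
  by rewrite conjgM conjgM -bk bk' -(conjgM _ k' w') conjgK.
have Gu : G u.
  apply/closureP => n.
  have [||m um] := @odometer_centralizer (a 0%N) _ n u.
  - by exists (pairW (\prod_(1 <= j < r) a j) 1); apply: a0E.
  - by rewrite -{1}au (conjgE (a 0%N)) mulVKg.
  - exists (a 0%N ^+ m) => //; apply: (subgroupX _ A_subgroup).
    exact: A_all.
have -> : w * w'^-1 = k^-1 * u * k'.
  by rewrite /u invgM !mulgA mulVg mul1g mulgVK.
exact: GM (GM _ _ (GV _ Gk) Gu) Gk'.
Qed.

End Main.

Unset Implicit Arguments.

Theorem theorem2p7p6 (r : nat) (a b : nat -> W)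
    (G := top_generated [set a i | i in [set i : nat | (1 <= i <= r)%N]])
    (cond_a :=
      [/\ conjugate (b 0%N) (pairW (b 0%N) 1 * sigma),
          conjugate (b 1%N) (pairW (b r) 1 * sigma)
        & forall i : nat, (2 <= i <= r)%N ->
            conjugate (b i) (pairW (b i.-1) 1)])
    (cond_b := forall i : nat, (i <= r)%N -> conjugate (b i) (a i))
    (cond_c := fun w : W => exists x : nat -> W,
      forall i : nat, (i <= r)%N ->
        G (x i) /\ b i = (w * x i) * a i * (w * x i)^-1) :
  (1 <= r)%N ->
  generators_recursion r a ->
  zeroth_is_product r a ->
  zeroth_is_product r b ->
  [/\ cond_a <-> cond_b,
      cond_b <-> (exists w : W, cond_c w),
      forall w : W, cond_c w ->
        top_generated [set b i | i in [set i : nat | (i <= r)%N]] =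
          [set w * g * w^-1 | g in G]
    & forall w w' : W, cond_c w -> cond_c w' ->
        [set w * g | g in G] = [set w' * g | g in G]].
Proof.
move=> r_gt0 aP a0P b0P.
have sG : subgroup G by apply/closure_subgroup/generated_subgroup.
have [_ GM GV] := sG.
have bP : cond_b <-> forall i, (i <= r)%N -> exists g, b i = a i ^ g.
  by split=> H i ir; apply/conjugateP; apply: H.
(* Passing to right conjugation inverts both [w] and the [x i]; the group [G] is stable under
   inverses. *)
have cP w : cond_c w <->
    forall i, (i <= r)%N -> exists2 k, G k & b i = (a i ^ k) ^ w^-1.
  split=> [[x xP] i /xP[Gx ->]|H].
    exists (x i)^-1; first exact: GV.
    by rewrite -conjgM -invgM conjgE invgK mulgA.
  have {}H i : exists x, (i <= r)%N ->
      G x /\ b i = (w * x) * a i * (w * x)^-1.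
    have [/H[k Gk ->]|_] := boolP (i <= r)%N; last by exists 1.
    exists k^-1 => _; split; first exact: GV.
    by rewrite -conjgM -{1}(invgK k) -invgM conjgE invgK mulgA.
  by have [x xP] := choice H; exists x.
split.
- split=> [[/conjugateP H0 /conjugateP H1 HS]|/bP H].
    apply/bP; apply: conjugate_of_recursive => //; split=> // i ir.
    exact/conjugateP/HS.
  have [H0 H1 HS] := recursive_of_conjugate r_gt0 aP a0P H.
  by split; [apply/conjugateP|apply/conjugateP|move=> i /HS/conjugateP].
- split=> [/bP H|[w /cP H]].
    have [w wP] := simultaneous_of_conjugate r_gt0 aP a0P b0P H.
    by exists w^-1; apply/cP; rewrite invgK.
  by apply/bP => i /H[k _ ->]; exists (k * w^-1); rewrite conjgM.
- move=> w /cP H; rewrite [LHS](generated_of_simultaneous r_gt0 aP a0P b0P H).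
  by congr image; apply/funext => g; rewrite conjgE invgK mulgA.
- have uniq w w' : cond_c w -> cond_c w' -> G (w^-1 * w').
    move=> /cP/(_ 0%N isT) H /cP/(_ 0%N isT) H'.
    by rewrite -[w']invgK; apply: simultaneous_unique H H'.
  suff sub w w' : cond_c w -> cond_c w' ->
      [set w * g | g in G] `<=` [set w' * g | g in G].
    by move=> w w' cw cw'; apply/seteqP; split; apply: sub.
  move=> cw cw' _ [g Gg <-]; exists (w'^-1 * w * g); last by rewrite -mulgA mulVKg.
  by apply: GM Gg; apply: uniq.
Qed.
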